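(* Let $(A,p,0,\frac12,1)$ be a mobi algebra and let $2\in A$ be a distinguished element. Define $a\cdot b=p(0,a,b)$ and $a+b=2\cdot p(a,\frac12,b)$ for all $a,b\in A$. Then the structure $(A,+,\cdot,0,1)$ is a unitary ring if and only if $2$ is the inverse of $\frac12$ (with respect to $\cdot$, i.e. $2\cdot\frac12=1=\frac12\cdot 2$).
   Context: A mobi algebra is a system $(A,p,0,\frac12,1)$, where $A$ is a set, $p:A^3\to A$ is a ternary operation and $0,\frac12,1$ are elements of $A$ ($\frac12$ is only a symbol for a distinguished element), such that for all elements of $A$: (A1) $p(1,\frac12,0)=\frac12$; (A2) $p(0,a,1)=a$; (A3) $p(a,b,a)=a$; (A4) $p(a,0,b)=a$; (A5) $p(a,1,b)=b$; (A6) $p(a,\frac12,b)=p(a',\frac12,b)\implies a=a'$; (A7) $p(a,p(c_1,c_2,c_3),b)=p(p(a,c_1,b),c_2,p(a,c_3,b))$; (A8) $p(p(a_1,c,b_1),\frac12,p(a_2,c,b_2))=p(p(a_1,\frac12,a_2),c,p(b_1,\frac12,b_2))$. The symbol $2$ denotes an arbitrary chosen element of $A$. A unitary ring is an associative ring with zero $0$ and multiplicative identity $1$, not assumed commutative (and possibly with $0=1$). *)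

(* Defs.v *)
From mathcomp Require Import all_boot all_algebra.

Set Implicit Arguments.
Unset Strict Implicit.
Unset Printing Implicit Defensive.

Record mobi_algebra (A : Type) (p : A -> A -> A -> A) (zero half one : A) :
    Prop := MobiAlgebra {
  mobiA1 : p one half zero = half;
  mobiA2 : forall a, p zero a one = a;
  mobiA3 : forall a b, p a b a = a;
  mobiA4 : forall a b, p a zero b = a;
  mobiA5 : forall a b, p a one b = b;
  mobiA6 : forall a a' b, p a half b = p a' half b -> a = a';
  mobiA7 : forall a b c1 c2 c3,
    p a (p c1 c2 c3) b = p (p a c1 b) c2 (p a c3 b);
  mobiA8 : forall a1 b1 a2 b2 c,
    p (p a1 c b1) half (p a2 c b2) = p (p a1 half a2) c (p b1 half b2)
}.

Definition mobi_mul (A : Type) (p : A -> A -> A -> A) (zero : A) (a b : A) : A :=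
  p zero a b.

Definition mobi_add (A : Type) (p : A -> A -> A -> A) (zero half two : A)
    (a b : A) : A :=
  mobi_mul p zero two (p a half b).

(* A predicate rather than [pzRingType], because the carrier is a bare type with
   given operations: [pzRingType] would also require a [choiceType] and the
   opposite as data.  As in [pzRingType], [zero = one] is allowed. *)
Record unitary_ring (A : Type) (add mul : A -> A -> A) (zero one : A) :
    Prop := UnitaryRing {
  ur_addA : associative add;
  ur_addC : commutative add;
  ur_add0 : left_id zero add;
  ur_addN : forall a, exists b, add b a = zero;
  ur_mulA : associative mul;
  ur_mul1l : left_id one mul;
  ur_mul1r : right_id one mul;
  ur_mulDl : left_distributive mul add;
  ur_mulDr : right_distributive mul add
}.

Lemma pzRing_unitary_ring (R : pzRingType) :
  unitary_ring (@GRing.add R) (@GRing.mul R) (0%R : R) (1%R : R).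
Proof.
split; [exact: GRing.addrA | exact: GRing.addrC | exact: GRing.add0r |
  | exact: GRing.mulrA | exact: GRing.mul1r | exact: GRing.mulr1
  | exact: GRing.mulrDl | exact: GRing.mulrDr].
by move=> a; exists (GRing.opp a); exact: GRing.addNr.
Qed.

(* Main.v *)
(* The midpoint m(a, b) = p(a, 1/2, b) is commutative and medial, the product
   distributes over it, and 1/2 = m(0, 1) is central because
   c * m(0, 1) = m(0, c). If 2 inverts 1/2 then 2 is central too, the ring axioms
   for a + b = 2 * m(a, b) follow from those properties of m, and p(a, 2, 0) is
   the opposite of a. Conversely, in a ring 0 + 1 = 1 reads 2 * 1/2 = 1, and 1/2
   is central. *)

Require Import Defs.
From mathcomp Require Import all_boot all_algebra.

Section MobiAlgebraTheory.

Context (A : Type) (p : A -> A -> A -> A) (zero half one : A).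
Context (hA : mobi_algebra p zero half one).

Local Notation "a ** b" := (mobi_mul p zero a b)
  (at level 40, left associativity).
Local Notation mid a b := (p a half b).

Lemma mobi_mulA : associative (mobi_mul p zero).
Proof. by move=> a b c; rewrite /mobi_mul (mobiA7 hA) (mobiA4 hA). Qed.

Lemma mobi_mul1l : left_id one (mobi_mul p zero).
Proof. by move=> a; apply: (mobiA5 hA). Qed.

Lemma mobi_mul1r : right_id one (mobi_mul p zero).
Proof. by move=> a; apply: (mobiA2 hA). Qed.

Lemma mobi_mul0r : right_zero zero (mobi_mul p zero).
Proof. by move=> a; apply: (mobiA3 hA). Qed.

(** The map [c => p b c a] preserves midpoints by A7 and sends [one], [zero] to [a], [b]; A1 then
    swaps the endpoints. *)
Lemma mobi_midC a b : mid a b = mid b a.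
Proof.
rewrite -{1}(mobiA5 hA b a) -{2}(mobiA4 hA b a) -(mobiA7 hA).
by rewrite (mobiA1 hA).
Qed.

Lemma mobi_mid_mull a b c : c ** mid a b = mid (c ** a) (c ** b).
Proof. by rewrite /mobi_mul (mobiA8 hA) (mobiA3 hA). Qed.

Lemma mobi_mid_mulr a b c : mid a b ** c = mid (a ** c) (b ** c).
Proof. exact: (mobiA7 hA). Qed.

Lemma mobi_half_mulC c : half ** c = c ** half.
Proof.
by rewrite -{2}(mobiA2 hA half) mobi_mid_mull mobi_mul0r mobi_mul1r.
Qed.

Lemma mobi_ring_half_inverse two :
    unitary_ring (mobi_add p zero half two) (mobi_mul p zero) zero one ->
  two ** half = one /\ half ** two = one.
Proof.
move=> hR; suff two_half: two ** half = one by rewrite mobi_half_mulC.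
by have := ur_add0 hR one; rewrite /mobi_add (mobiA2 hA).
Qed.

Section HalfInverse.

Context (two : A) (two_half : two ** half = one) (half_two : half ** two = one).

Local Notation "a ++ b" := (mobi_add p zero half two a b).

(** Identities about [++] can thus be checked after halving, where sums become midpoints. *)
Lemma mobi_half_mulI a b : half ** a = half ** b -> a = b.
Proof.
by move=> eq_ab; rewrite -[a]mobi_mul1l -[b]mobi_mul1l -two_half -!mobi_mulA eq_ab.
Qed.

Lemma mobi_half_add a b : half ** (a ++ b) = mid a b.
Proof. by rewrite /mobi_add mobi_mulA half_two mobi_mul1l. Qed.

Lemma mobi_two_mulC c : two ** c = c ** two.
Proof.
apply: mobi_half_mulI.
by rewrite !mobi_mulA half_two mobi_half_mulC -mobi_mulA half_two mobi_mul1l mobi_mul1r.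
Qed.

(* After halving twice, associativity is the medial law A8 applied to
   a, b, 0, c. *)
Lemma mobi_addA : associative (mobi_add p zero half two).
Proof.
move=> a b c; do 2!apply: mobi_half_mulI.
rewrite !mobi_half_add !mobi_mid_mull !mobi_half_add /mobi_mul.
by rewrite (mobi_midC zero a) (mobiA8 hA).
Qed.

Lemma mobi_half_inverse_ring :
  unitary_ring (mobi_add p zero half two) (mobi_mul p zero) zero one.
Proof.
split.
- exact: mobi_addA.
- by move=> a b; rewrite /mobi_add mobi_midC.
(* [half ** a] is by definition the midpoint of [zero] and [a]. *)
- by move=> a; apply: mobi_half_mulI; rewrite mobi_half_add.
(* The map [c => p a c zero] preserves midpoints, and [one] is the midpoint of [zero] and [two]; so
   [zero], the image of [one], is the midpoint of [a] and the witness. *)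
- move=> a; exists (p a two zero).
  apply: mobi_half_mulI; rewrite mobi_half_add mobi_mul0r mobi_midC.
  rewrite -{1}(mobiA4 hA a zero) -(mobiA7 hA).
  by rewrite -/(half ** two) half_two (mobiA5 hA).
- exact: mobi_mulA.
- exact: mobi_mul1l.
- exact: mobi_mul1r.
- by move=> a b c; rewrite /mobi_add -mobi_mulA mobi_mid_mulr.
- move=> c a b; rewrite /mobi_add.
  (* Centrality moves [two] to the left of [c]. *)
  by rewrite mobi_mulA -mobi_two_mulC -mobi_mulA mobi_mid_mull.
Qed.

End HalfInverse.

End MobiAlgebraTheory.

Theorem theorem7p1 (A : Type) (p : A -> A -> A -> A) (zero half one : A)
    (hA : mobi_algebra p zero half one) (two : A) :
  unitary_ring (mobi_add p zero half two) (mobi_mul p zero) zero one <->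
  (mobi_mul p zero two half = one /\ mobi_mul p zero half two = one).
Proof.
split; first exact: mobi_ring_half_inverse.
by case=> two_half half_two; apply: mobi_half_inverse_ring.
Qed.
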